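(* Let $\mathcal H$ be a real Hilbert space, and let $f:\mathcal H\to\mathbb R$ be a convex smooth function whose gradient $\nabla f$ is $L$-Lipschitz continuous and such that $\operatorname{argmin}_{\mathcal H} f\neq\emptyset$. Let $(x_k)_{k\in\mathbb N}$ be a sequence generated by the inexact algorithm I-IGAHD (described in the context), with gradient errors $(M^x_k)$, $(M^y_k)$ in $\mathcal H$, with $\alpha>3$ and a constant step-size $s_k\equiv s>0$. Assume that $$\sum_{k\in\mathbb N} s_k k\|M^x_k\|<+\infty\quad\text{and}\quad \sum_{k\in\mathbb N} s_k k\|M^y_k\|<+\infty .$$ Then (i) $f(x_k)-\min_{\mathcal H}f=o\left(\frac1{k^2}\right)$ as $k\to+\infty$, and (ii) $\|x_k-x_{k-1}\|=o\left(\frac1k\right)$ as $k\to+\infty$.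
   Context: Algorithm I-IGAHD (inexact inertial gradient algorithm with Hessian driven damping): given an initial point $x_1=x_0\in\mathcal H$, step-sizes $s_k\in\,]0,1/L]$, parameters $(\alpha,\beta_k)$ satisfying $\alpha\geq 3$ and $0\le\beta_k<2\sqrt{s_k}$, and (deterministic) error sequences $(M^x_k)$, $(M^y_k)$ in $\mathcal H$, set for $k=1,2,\dots$: $\alpha_k=1-\frac{\alpha}{k}$, $$y_k=x_k+\alpha_k(x_k-x_{k-1})-\beta_k\sqrt{s_k}\,(\nabla f(x_k)+M^x_k)+\beta_{k-1}\sqrt{s_{k-1}}\left(1-\tfrac1k\right)(\nabla f(x_{k-1})+M^x_{k-1}),$$ $$x_{k+1}=y_k-s_k(\nabla f(y_k)+M^y_k).$$ *)

(* Defs.v *)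
From mathcomp Require Import all_boot all_order all_algebra.
From mathcomp Require Import all_classical all_reals all_analysis.

Set Implicit Arguments.
Unset Strict Implicit.
Unset Printing Implicit Defensive.

Import Order.TTheory GRing.Theory Num.Theory.
Import numFieldNormedType.Exports.

Local Open Scope classical_set_scope.
Local Open Scope ring_scope.

(* A real Hilbert space is a complete normed module over R : realType, together
   with a symmetric positive definite bilinear form [ip : {dot H for idfun}]
   from which its norm comes. *)
Definition induces_norm (R : realType) (H : completeNormedModType R)
    (ip : {dot H for (@idfun R)}) : Prop :=
  forall u : H, `|u| ^+ 2 = ip u u.

(* [gradf x] is the Riesz representative of the Frechet differential at [x]. *)
Definition is_gradient (R : realType) (H : completeNormedModType R)
    (ip : {dot H for (@idfun R)}) (f : H -> R^o) (gradf : H -> H) : Prop :=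
  forall x : H, differentiable f x /\ forall h : H, 'd f x h = ip (gradf x) h.

Definition argmin (R : realType) (T : Type) (f : T -> R) : set T :=
  [set z | forall u, f z <= f u].

(* The infimum of [f], which is its minimum as soon as [argmin f] is nonempty. *)
Definition minval (R : realType) (T : Type) (f : T -> R) : R :=
  inf (range f).

(* The sequences are indexed from 0, but the values at 0 of [s], [beta] and [Mx]
   only occur in the recursion with the coefficient 1 - 1/1 = 0, and those of
   [y] and [My] do not occur. *)
Record I_IGAHD (R : realType) (H : completeNormedModType R) (L alpha : R)
    (s beta : nat -> R) (gradf : H -> H) (Mx My x y : nat -> H) : Prop := {
  igahd_alpha : 3 <= alpha;
  igahd_step : forall k, 0 < s k <= 1 / L;
  igahd_beta : forall k, 0 <= beta k < 2 * Num.sqrt (s k);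
  igahd_init : x 1%N = x 0%N;
  igahd_y : forall k, (1 <= k)%N ->
    y k = x k + (1 - alpha / k%:R) *: (x k - x k.-1)
          - (beta k * Num.sqrt (s k)) *: (gradf (x k) + Mx k)
          + (beta k.-1 * Num.sqrt (s k.-1) * (1 - 1 / k%:R))
              *: (gradf (x k.-1) + Mx k.-1);
  igahd_x : forall k, (1 <= k)%N ->
    x k.+1 = y k - s k *: (gradf (y k) + My k)
}.

(* Main.v *)
Require Import Defs.
From mathcomp Require Import all_boot all_order all_algebra.
From mathcomp Require Import all_classical all_reals all_analysis.
From mathcomp Require Import ring lra.

Set Implicit Arguments.
Unset Strict Implicit.
Unset Printing Implicit Defensive.

Import Order.TTheory GRing.Theory Num.Theory.
Import numFieldNormedType.Exports.

Local Open Scope classical_set_scope.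
Local Open Scope ring_scope.

(* Put t_k = (k - 1) / (alpha - 1), g_k = grad f (x_k) + Mx_k and
   w_k = x_k - x_{k-1} + beta_{k-1} sqrt s g_{k-1}.  For z in argmin f the
   vector v_k = x_{k-1} - z + t_k w_k satisfies the exact recursion
   v_{k+1} = v_k - s t_{k+1} (grad f (y_k) + My_k), whatever the variations of
   beta_k.  Since L s <= 1, the co-coercivity inequality also applies between
   x_{k+1} and y_k, and it yields an additional decrease of order
   s t_{k+1}^2 |grad f (x_{k+1})|^2.  This decrease pays at the next step for
   the cross term in beta_k <grad f (x_k), grad f (y_k)>, which is not
   controlled otherwise when beta_k tends to 2 sqrt s.  Hence
     t_k^2 (f x_k - min f) + |v_k|^2 / (2 s) + s t_k^2 |grad f (x_k)|^2 / 4
   is a Lyapunov function in the sense of Robbins and Siegmund, and the series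
   of k (f x_k - min f) and of k^2 |grad f (x_k)|^2 converge.  The same
   computation with v_k replaced by t_k w_k then shows that the series of
   k |w_k|^2 converges and that
     U_k = t_k^2 (f x_k - min f) + t_k^2 |w_k|^2 / (2 s)
           + s t_k^2 |grad f (x_k)|^2 / 4
   has a limit; as the series of U_k / k converges, this limit is 0, which gives
   both rates. *)

(** * Summable sequences *)

Section Series.
Context (R : realType).
Implicit Types (u v F G : nat -> R).

Lemma is_cvgn_shift K u : cvgn (fun n => u (n + K)%N) -> cvgn u.
Proof.
by move=> /cvg_ex[l ul]; apply: (@cvgP _ _ l); rewrite -(cvg_shiftn K).
Qed.

Lemma is_cvg_series_shift K u :
  cvgn (series (fun n => u (n + K)%N)) <-> cvgn (series u).
Proof.
have E n : series u (n + K)%N = series u K + series (fun n => u (n + K)%N) n.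
  rewrite !seriesEnat/= addnC (@big_cat_nat _ _ _ K) ?leq_addr//=.
  by rewrite -{2}(add0n K) big_addn addKn.
split=> cu.
  apply: (@is_cvgn_shift K); under eq_fun do rewrite E.
  by apply: is_cvgD => //; exact: is_cvg_cst.
have -> : series (fun n => u (n + K)%N) =
    (fun n => series u (n + K)%N - series u K).
  by apply/funext => n; rewrite E addrC addKr.
apply: is_cvgB; last exact: is_cvg_cst.
by move: cu => /cvg_ex[l ul]; apply: (@cvgP _ _ l); rewrite (cvg_shiftn K).
Qed.

Lemma is_cvg_series_le K u v : (forall n, (K <= n)%N -> 0 <= u n <= v n) ->
  cvgn (series v) -> cvgn (series u).
Proof.
move=> uv /((is_cvg_series_shift K v).2) cv; apply/(is_cvg_series_shift K).
have {}uv n := uv _ (leq_addl n K).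
apply: series_le_cvg cv => n; have /andP[u0 uvn] := uv n => //.
exact: le_trans uvn.
Qed.

Lemma is_cvg_series_add u v : cvgn (series u) -> cvgn (series v) ->
  cvgn (series (fun n => u n + v n)).
Proof.
by move=> cu cv; rewrite -[X in series X]/(u + v); exact: is_cvg_seriesD.
Qed.

Lemma is_cvg_series_scale c u : cvgn (series u) ->
  cvgn (series (fun n => c * u n)).
Proof.
move=> cu; rewrite -[X in series X]/(c *: (u : nat -> R^o)).
exact: is_cvg_seriesZ.
Qed.

(** The terms tend to 0, so they are eventually below 1, where squaring decreases them. *)
Lemma is_cvg_series_sqr u : (forall n, 0 <= u n) -> cvgn (series u) ->
  cvgn (series (fun n => u n ^+ 2)).
Proof.
move=> u0 cu.
have /cvgrPdist_lt/(_ _ ltr01)[N _ hN] := cvg_series_cvg_0 cu.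
apply: (is_cvg_series_le _ cu) => n Nn; rewrite sqr_ge0/=.
have := hN n Nn; rewrite sub0r normrN ger0_norm// => u1.
by rewrite expr2 ler_piMl// ltW.
Qed.

Lemma le_series_lim u : (forall n, 0 <= u n) -> cvgn (series u) ->
  forall n, series u n <= limn (series u).
Proof.
move=> u0 cu; apply: nondecreasing_cvgn_le => //.
by apply: nondecreasing_series.
Qed.

(** A discrete Gronwall bound [F n <= B] turns the factor [1 + eps n] into the additive summable
    error [B * eps n]. What is left is a monotone bounded sequence. *)
Lemma robbins_siegmund_from0 F G (eps del : nat -> R) :
  (forall n, [/\ 0 <= F n, 0 <= G n, 0 <= eps n & 0 <= del n]) ->
  (forall n, F n.+1 + G n <= (1 + eps n) * F n + del n) ->
  cvgn (series eps) -> cvgn (series del) -> cvgn F /\ cvgn (series G).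
Proof.
move=> pos step ceps cdel.
have F0 n : 0 <= F n by case: (pos n).
have G0 n : 0 <= G n by case: (pos n).
have e0 n : 0 <= eps n by case: (pos n).
have d0 n : 0 <= del n by case: (pos n).
have S0 u n : (forall n, 0 <= u n) -> 0 <= series u n.
  by move=> u0; apply: sumr_ge0.
(* The product of the factors [1 + eps i] is controlled through [1 + e <= expR e]. *)
have bnd n : F n <= expR (series eps n) * (F 0%N + series del n).
  elim: n => [|n IH]; first by rewrite /series/= !big_geq// expR0 mul1r addr0.
  rewrite !seriesSr expRD.
  have e1 : 1 <= expR (series eps n) * expR (eps n).
    by rewrite -expRD -expR0 ler_expR addr_ge0// S0.
  have := step n; have := G0 n => Gn stepn.
  have h1 : (1 + eps n) * F n <=
      expR (eps n) * (expR (series eps n) * (F 0%N + series del n)).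
    by apply: ler_pM => //; [rewrite addr_ge0|exact: expR_ge1Dx].
  have h2 : del n <= expR (series eps n) * expR (eps n) * del n.
    by rewrite ler_peMl.
  by lra.
pose B := expR (limn (series eps)) * (F 0%N + limn (series del)).
have FB n : F n <= B.
  apply: le_trans (bnd n) _; apply: ler_pM; rewrite ?expR_ge0 ?addr_ge0 ?S0//.
    by rewrite ler_expR le_series_lim.
  by rewrite lerD2l le_series_lim.
pose d n := B * eps n + del n.
have cd : cvgn (series d).
  exact: is_cvg_series_add (is_cvg_series_scale (c := B) ceps) cdel.
have dn0 n : 0 <= d n.
  by rewrite addr_ge0// mulr_ge0// (le_trans (F0 0%N)).
have step' n : F n.+1 + G n <= F n + d n.
  apply: le_trans (step n) _; rewrite mulrDl mul1r -addrA lerD2l lerD2r.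
  by rewrite mulrC ler_wpM2r.
(* [W] is nonincreasing and bounded below; the bound [W n <= F 0] then controls the partial sums of
   [G]. *)
pose W n := F n + series G n - series d n.
have cW : cvgn W.
  apply: nonincreasing_is_cvgn.
    apply/nonincreasing_seqP => n; rewrite /W !seriesSr.
    by have := step' n; lra.
  exists (- limn (series d)) => _ [n _ <-]; rewrite /W.
  by have := le_series_lim dn0 cd n; have := S0 _ n G0; have := F0 n; lra.
have cG : cvgn (series G).
  apply: nondecreasing_is_cvgn; first exact: nondecreasing_series.
  exists (F 0%N + limn (series d)) => _ [n _ <-].
  have WF : W n <= F 0%N.
    elim: n => [|n IH]; first by rewrite /W /series/= !big_geq// addr0 subr0.
    by apply: le_trans IH; rewrite /W !seriesSr; have := step' n; lra.
  by have := le_series_lim dn0 cd n; have := F0 n; move: WF; rewrite /W; lra.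
split=> //.
have -> : F = (fun n => W n - series G n + series d n).
  by apply/funext => n; rewrite /W; ring.
by apply: is_cvgD => //; apply: is_cvgB.
Qed.

Lemma robbins_siegmund K F G (eps del : nat -> R) :
  (forall n, (K <= n)%N -> [/\ 0 <= F n, 0 <= G n, 0 <= eps n & 0 <= del n]) ->
  (forall n, (K <= n)%N -> F n.+1 + G n <= (1 + eps n) * F n + del n) ->
  cvgn (series eps) -> cvgn (series del) -> cvgn F /\ cvgn (series G).
Proof.
move=> pos step /((is_cvg_series_shift K eps).2) ceps
  /((is_cvg_series_shift K del).2) cdel.
have [cF cG] := robbins_siegmund_from0 (fun n => pos _ (leq_addl n K))
  (fun n => step _ (leq_addl n K)) ceps cdel.
by split; [exact: is_cvgn_shift cF|apply/(is_cvg_series_shift K)].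
Qed.

(* A positive limit would make the harmonic series converge. *)
Lemma cvgn0_of_harmonic_series F : (forall n, 0 <= F n) -> cvgn F ->
  cvgn (series (fun n => F n * harmonic n)) -> F @ \oo --> 0.
Proof.
move=> F0 cF cFh.
have l0 : 0 <= limn F by apply: limr_ge => //; apply: nearW.
have [l_gt0|] := ltP 0 (limn F); last first.
  by move=> l_le0; have /eqP <- : limn F == 0 by rewrite eq_le l_le0.
have l2 : 0 < limn F / 2 by rewrite divr_gt0.
have /cvgrPdist_lt/(_ _ l2)[N _ hN] := cF.
exfalso; apply: (@dvg_harmonic R).
apply: (@is_cvg_series_le N _ _ _
  (is_cvg_series_scale (c := (limn F / 2)^-1) cFh)) => n Nn.
have h0 : 0 <= @harmonic R n by exact: harmonic_ge0.
rewrite h0/= ler_pdivlMl// ler_wpM2r//.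
have := hN n Nn; rewrite /= ltr_distlC => /andP[+ _]; lra.
Qed.

End Series.

(** * Convex functions with a Lipschitz gradient *)

(* For lam = gam - 1 = 1 the quadratic form without the last two terms takes
   the value - (3 / 2) a ^+ 2 at b = - a; the term T / 16 * a ^+ 2 makes up for
   this and leaves the margin T / 32 * b ^+ 2, which absorbs the errors. *)
Lemma energy_form (R : realType) (T lam gam a b ab : R) :
  100 <= T -> 0 <= lam <= 1 ->
  0 <= gam <= 2 -> 0 <= a -> 0 <= b -> `|ab| <= a * b ->
  0 <= T * gam * ab + (T - lam) / 2 * (a ^+ 2 + b ^+ 2 - 2 * ab)
       + lam / 2 * b ^+ 2 + T / 16 * a ^+ 2 - T / 32 * b ^+ 2.
Proof.
move=> hT /andP[l0 l1] /andP[g0 g2] a0 b0 hab.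
(* This is the total coefficient of [ab] once the form is expanded. *)
have hc : `|T * (gam - 1) + lam| <= T + 1.
  by rewrite ler_norml; apply/andP; split; nra.
have : `|(T * (gam - 1) + lam) * ab| <= (T + 1) * (a * b).
  by rewrite normrM ler_pM.
move=> /ler_normlP[+ _].
have ab0 : 0 <= a * b by rewrite mulr_ge0.
have h1 : (T + 1) * (a * b) <= T * (101 / 100 * (a * b)) by nra.
(* Here 15/32 = 1/2 - 1/32 is the coefficient left for [b ^+ 2], and 1115/2000 = 1/2 + 1/16 - 1/200
   is a lower bound of the one left for [a ^+ 2], as [lam / 2 <= T / 200]. The ratio 0.9058
   completes the square. *)
have h2 : T * (101 / 100 * (a * b)) <=
    T * (15 / 32 * b ^+ 2 + 1115 / 2000 * a ^+ 2).
  rewrite ler_pM2l; last by lra.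
  have := sqr_ge0 (a - 9058 / 10000 * b); have := sqr_ge0 b; nra.
have h3 : lam * a ^+ 2 <= T / 100 * a ^+ 2.
  by apply: ler_wpM2r; [exact: sqr_ge0|lra].
by have := sqr_ge0 a; nra.
Qed.

Section InnerProduct.
Context (R : realType) (H : completeNormedModType R).
Context (ip : {dot H for (@idfun R)}).

(** * Calculus in the inner product *)

Lemma ipC u v : ip u v = ip v u.
Proof. by rewrite hermC expr0 mul1r. Qed.

Lemma ipDl u v w : ip (u + v) w = ip u w + ip v w.
Proof. exact: linearDl. Qed.

Lemma ipNl u w : ip (- u) w = - ip u w.
Proof. exact: linearNl. Qed.

Lemma ipZl a u w : ip (a *: u) w = a * ip u w.
Proof. exact: linearZl_LR. Qed.

Lemma ipDr u v w : ip w (u + v) = ip w u + ip w v.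
Proof. by rewrite ipC ipDl !(ipC w). Qed.

Lemma ipNr u w : ip w (- u) = - ip w u.
Proof. by rewrite ipC ipNl (ipC w). Qed.

Lemma ipZr a u w : ip w (a *: u) = a * ip w u.
Proof. by rewrite ipC ipZl (ipC w). Qed.

Definition ipE := (ipDl, ipDr, ipNl, ipNr, ipZl, ipZr).

Context (hip : induces_norm ip).

Lemma ip_normr u : ip u u = `|u| ^+ 2.
Proof. by rewrite hip. Qed.

(** Reduces identities between vectors to identities between scalars, within reach of [ring] and
    [field]. *)
Lemma ip_inj (a b : H) : (forall h, ip a h = ip b h) -> a = b.
Proof.
move=> ab; apply/eqP; rewrite -subr_eq0 -normr_eq0 -sqrf_eq0.
by rewrite -ip_normr ipDl ipNl ab subrr.
Qed.

Lemma normrD_sqr u v : `|u + v| ^+ 2 = `|u| ^+ 2 + 2 * ip u v + `|v| ^+ 2.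
Proof. by rewrite -!ip_normr !ipE (ipC v u); ring. Qed.

Lemma normrB_sqr u v : `|u - v| ^+ 2 = `|u| ^+ 2 - 2 * ip u v + `|v| ^+ 2.
Proof. by rewrite -!ip_normr !ipE (ipC v u); ring. Qed.

(** The triangle inequality comes with the norm; squaring and expanding it leaves exactly this. *)
Lemma cauchy_schwarz u v : ip u v <= `|u| * `|v|.
Proof.
have : `|u + v| ^+ 2 <= (`|u| + `|v|) ^+ 2.
  by rewrite ler_pXn2r ?nnegrE ?addr_ge0// ler_normD.
by rewrite normrD_sqr sqrrD; lra.
Qed.

Lemma cauchy_schwarz_norm u v : `|ip u v| <= `|u| * `|v|.
Proof.
rewrite ler_norml cauchy_schwarz andbT lerNl -ipNl.
by rewrite -(normrN u) cauchy_schwarz.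
Qed.

(** * First-order inequalities for [f], and one step of the energy *)

Context (f : H -> R^o) (gradf : H -> H) (L : R).
Context (hconvex : convex_function setT f) (hgrad : is_gradient ip f gradf).
Context (hL : 0 < L) (hlip : L.-lipschitz gradf).

Lemma is_derive_segment (x h : H) (t : R) :
  is_derive t 1 (fun r : R => f (x + r *: h) : R) (ip (gradf (x + t *: h)) h).
Proof.
have [df eq_d] := hgrad (x + t *: h).
have := @diff_derivable _ _ _ _ _ h df; have := deriveE h df; rewrite eq_d.
rewrite /derive /derivable.
have -> : (fun k : R => k^-1 *: (f (k *: h + (x + t *: h)) - f (x + t *: h))) =
  (fun k : R => k^-1 *: (f (x + (k *: (1 : R^o) + t) *: h) - f (x + t *: h))).
  apply/funext => k; congr (_ *: (f _ - _)).
  by rewrite scalerDl /GRing.scale/= mulr1 addrCA.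
by move=> dE dd; split.
Qed.

(** Mean value theorem on [0, 1] for [g], whose derivative is nonpositive by the Lipschitz bound.
    The sign [e] gives both sides: 1 for the descent lemma, -1 for the gradient inequality. *)
Lemma quadratic_bound (e : R) (x h : H) : `|e| <= 1 ->
  e * (f (x + h) - f x - ip (gradf x) h) <= L / 2 * `|h| ^+ 2.
Proof.
move=> he.
pose g (r : R) : R := e * (f (x + r *: h) - r * ip (gradf x) h) -
   r ^+ 2 * (L / 2 * `|h| ^+ 2).
pose dg (r : R) : R := e * (ip (gradf (x + r *: h)) h - ip (gradf x) h) -
   2 * r * (L / 2 * `|h| ^+ 2).
have gd (r : R) : is_derive r 1 g (dg r).
  have d1 := is_derive_segment x h r.
  have := is_deriveB (is_deriveZ e (is_deriveB d1
    (is_deriveZ (ip (gradf x) h) (is_derive_id r (1 : R)))))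
    (is_deriveZ (L / 2 * `|h| ^+ 2) (is_deriveX 2 (is_derive_id r (1 : R)))).
  set g1 := (X in is_derive _ _ X _); set dg1 := (X in is_derive _ _ _ X).
  have -> : g1 = g.
    apply/funext => u; rewrite /g1 /g.
    transitivity (e * (f (x + u *: h) - ip (gradf x) h * u) -
      L / 2 * `|h| ^+ 2 * u ^+ 2); first by [].
    by ring.
  suff -> : dg1 = dg r by [].
  by rewrite /dg1 /dg /GRing.scale/= !mulr1 expr1; ring.
have [] := @MVT R g dg 0 1 ltr01 (fun r _ => gd r).
  apply: continuous_subspaceT => r.
  apply/differentiable_continuous/derivable1_diffP.
  by have [] := gd r.
move=> c; rewrite in_itv/= => /andP[c0 c1].
rewrite subr0 mulr1 => gE.
suff : dg c <= 0.
  by rewrite -gE /g scale1r scale0r addr0 expr1n expr0n/=; lra.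
have lipc : `|gradf (x + c *: h) - gradf x| <= L * (c * `|h|).
  have := @hlip (x + c *: h, x) (conj I I); rewrite /=.
  by rewrite (addrC x) addrK normrZ (gtr0_norm c0).
have : `|e * ip (gradf (x + c *: h) - gradf x) h| <= L * (c * `|h|) * `|h|.
  rewrite normrM; apply: (@le_trans _ _ (1 * (L * (c * `|h|) * `|h|))).
    apply: ler_pM => //; apply: (le_trans (cauchy_schwarz_norm _ _)).
    exact: ler_wpM2r.
  by rewrite mul1r.
move=> /(le_trans (ler_norm _)); rewrite /dg !ipE; lra.
Qed.

Lemma descent_lemma x y :
  f y <= f x + ip (gradf x) (y - x) + L / 2 * `|y - x| ^+ 2.
Proof.
have := @quadratic_bound 1 x (y - x).
by rewrite normr1 subrKC => /(_ (lexx 1)); lra.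
Qed.

(** Convexity on the segment and the lower quadratic bound at [x + t *: h], divided by [t], give the
    claim up to [t * K], and [t] is arbitrarily small. *)
Lemma gradient_ineq x y : f x + ip (gradf x) (y - x) <= f y.
Proof.
set h := y - x; set K := L / 2 * `|h| ^+ 2.
have K0 : 0 <= K by rewrite mulr_ge0// ?divr_ge0 ?sqr_ge0// ltW.
have key (t : R) : 0 < t -> t <= 1 -> f x + ip (gradf x) h - t * K <= f y.
  move=> t0 t1.
  have := @quadratic_bound (- 1) x (t *: h); rewrite normrN1 => /(_ (lexx 1)).
  rewrite ipZr normrZ exprMn (gtr0_norm t0) => lb.
  have := @hconvex (Itv01 (ltW t0) t1) y x (in_setT _) (in_setT _).
  have yxt : t *: y + (1 - t) *: x = x + t *: h.
    by rewrite /h scalerBl scale1r scalerBr addrCA addrA.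
  rewrite convRE /conv/= yxt => cv.
  have tE : t * (f x + ip (gradf x) h - t * K) <= t * f y.
    have : f (x + t *: h) <= t * f y + (1 - t) * f x := cv.
    by rewrite /K; lra.
  by move: tE; rewrite ler_pM2l.
rewrite leNgt; apply/negP => lt_f.
set d := f x + ip (gradf x) h - f y.
have d0 : 0 < d by rewrite subr_gt0.
have dK : 0 < d + K by rewrite ltr_wpDr.
(* This [t] is at most 1 and satisfies [t * K <= d / 2], against [d <= t * K]; the denominator is
   positive even if [K] is 0. *)
have := key (d / (2 * (d + K))).
rewrite divr_gt0 ?mulr_gt0// ler_pdivrMr ?mulr_gt0// mul1r => /(_ isT).
have -> : d <= 2 * (d + K) by lra.
move=> /(_ isT).
have : d / (2 * (d + K)) * K <= d / 2.
  rewrite mulrAC invfM mulrA ler_pdivrMr//.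
  rewrite -mulrA (mulrC K) mulrA; nra.
rewrite /d; lra.
Qed.

Context (s : R) (hs : 0 < s) (hsL : s <= 1 / L).

(** The point [y + s *: D] is a gradient step from [y] for the convex function f - <grad f (x), .>,
    which [x] minimizes. It is bounded below by the gradient inequality at [x] and above by the
    descent lemma at [y]. *)
Lemma cocoercive x y :
  f x + ip (gradf x) (y - x) + s / 2 * `|gradf x - gradf y| ^+ 2 <= f y.
Proof.
set D := gradf x - gradf y.
have sL1 : s * L <= 1 by rewrite -ler_pdivlMr.
have := gradient_ineq x (y + s *: D).
have := descent_lemma y (y + s *: D).
have -> : y + s *: D - x = (y - x) + s *: D by rewrite addrAC.
rewrite (addrC y) addrK normrZ exprMn (gtr0_norm hs) !ipZr.
rewrite [ip (gradf x) (_ + _)]ipDr ipZr.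
have : ip (gradf x) D - ip (gradf y) D = `|D| ^+ 2.
  by rewrite -ip_normr {3}/D ipDl ipNl.
have D0 : 0 <= `|D| ^+ 2 by [].
have : L / 2 * (s ^+ 2 * `|D| ^+ 2) <= s / 2 * `|D| ^+ 2.
  have -> : L / 2 * (s ^+ 2 * `|D| ^+ 2) = (s * L) * (s / 2 * `|D| ^+ 2).
    by field.
  by rewrite ler_piMl// mulr_ge0// divr_ge0// ltW.
by move=> ? ? ? ?; have := ler_pM2l hs; nra.
Qed.

(** Otherwise a gradient step of length 1/L from [z] would strictly decrease [f]. *)
Lemma gradient_argmin z : argmin f z -> gradf z = 0.
Proof.
move=> fz; apply/eqP; rewrite -normr_eq0 -sqrf_eq0 eq_le sqr_ge0 andbT.
have := descent_lemma z (z - L^-1 *: gradf z).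
rewrite (addrC z) addrK normrN normrZ exprMn gtr0_norm ?invr_gt0//.
rewrite ipNr ipZr ip_normr => le1.
have := le_trans (fz _) le1.
have -> : L / 2 * (L^-1 ^+ 2 * `|gradf z| ^+ 2) = L^-1 / 2 * `|gradf z| ^+ 2.
  by field; rewrite gt_eqF.
move=> le2; have : L^-1 / 2 * `|gradf z| ^+ 2 <= 0 by lra.
by rewrite pmulr_rle0// divr_gt0 ?invr_gt0.
Qed.

(* The weight [lam] of the minimizer is 1 for the Lyapunov function built on v_k
   and 0 for the energy built on t_k w_k. *)
Lemma energy_step (T lam gam : R) (x y z p q x' v : H) :
  100 <= T -> 0 <= lam <= 1 -> 0 <= gam <= 2 -> argmin f z ->
  x' = y - s *: (gradf y + q) ->
  v = lam *: (x - z) + T *: (y - x + (gam * s) *: (gradf x + p)) ->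
  T ^+ 2 * (f x' - f z) + `|v - (s * T) *: (gradf y + q)| ^+ 2 / (2 * s)
    + s * T ^+ 2 / 4 * `|gradf x'| ^+ 2 <=
  T * (T - lam) * (f x - f z) + `|v| ^+ 2 / (2 * s)
    + s * T ^+ 2 / 16 * `|gradf x| ^+ 2 + T * `|q| * `|v|
    + 100 * s * T ^+ 2 * (`|p| ^+ 2 + `|q| ^+ 2).
Proof.
move=> hT hlam hgam hz x'E vE.
have T0 : 0 < T by lra.
(* The products of [gradf x'] with [gradf y] cancel, which leaves the full decrease in the norm of
   [gradf x']. *)
have h1 : f x' <= f y - s / 2 * `|gradf x'| ^+ 2 - s / 2 * `|gradf y| ^+ 2
                  - s * ip (gradf x') q.
  have := cocoercive x' y.
  have -> : y - x' = s *: (gradf y + q) by rewrite x'E opprB addrC subrK.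
  by rewrite normrB_sqr ipZr ipDr; lra.
have h2 : f y <= f x + ip (gradf y) (y - x)
    - s / 2 * (`|gradf x| ^+ 2 + `|gradf y| ^+ 2 - 2 * ip (gradf x) (gradf y)).
  have := cocoercive y x.
  by rewrite -(opprB y x) ipNr normrB_sqr (ipC (gradf y) (gradf x)); lra.
have h3 : f y <= f z + ip (gradf y) (y - z) - s / 2 * `|gradf y| ^+ 2.
  have := cocoercive y z.
  by rewrite (gradient_argmin hz) subr0 -(opprB y z) ipNr; lra.
have h4 : `|v - (s * T) *: (gradf y + q)| ^+ 2 / (2 * s) =
  `|v| ^+ 2 / (2 * s) - T * (ip (gradf y) v + ip q v)
  + s * T ^+ 2 / 2 * (`|gradf y| ^+ 2 + 2 * ip (gradf y) q + `|q| ^+ 2).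
  rewrite normrB_sqr normrZ ipZr exprMn real_normK ?num_real// normrD_sqr.
  by rewrite ipDr !(ipC v); field; rewrite gt_eqF.
have h5 : ip (gradf y) v = lam * (ip (gradf y) (y - z) - ip (gradf y) (y - x))
   + T * ip (gradf y) (y - x)
   + T * (gam * s) * (ip (gradf x) (gradf y) + ip (gradf y) p).
  by rewrite vE !ipE (ipC (gradf y) (gradf x)); ring.
have e1 := cauchy_schwarz_norm (gradf y) p.
have e2 := cauchy_schwarz_norm (gradf y) q.
have e3 := cauchy_schwarz_norm (gradf x') q.
have e4 := cauchy_schwarz_norm q v.
have e5 := cauchy_schwarz_norm (gradf x) (gradf y).
rewrite h4 h5.
move: h1 h2 h3 e1 e2 e3 e4 e5 => {h4 h5 x'E vE}.
move: (ip (gradf y) p) (ip (gradf y) q) (ip (gradf x') q) (ip q v).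
move: (ip (gradf x) (gradf y)) (ip (gradf y) (y - x)) (ip (gradf y) (y - z)).
move: (normr_ge0 v) (normr_ge0 p) (normr_ge0 q) (normr_ge0 (gradf x)).
move: (normr_ge0 (gradf y)) (normr_ge0 (gradf x')).
move: `|v| `|p| `|q| `|gradf x| `|gradf y| `|gradf x'| => V P Q A B A'.
move: (f x) (f y) (f z) (f x') => fx fy fz fx'.
move=> B0 A'0 V0 P0 Q0 A0 ab bd1 bd2 bp bq aq qv h1 h2 h3 e1 e2 e3 e4 e5.
(* Young inequalities: the two [B ^+ 2 / 64] use up the margin of [energy_form], and [A' ^+ 2 / 4]
   uses half of the decrease from [h1], the other half staying in the conclusion. *)
have E1 : - (gam * bp) <= B ^+ 2 / 64 + 64 * P ^+ 2.
  move: e1 => /ler_normlP[e1 e1'].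
  by have := sqr_ge0 (B / 8 - 8 * P); nra.
have E2 : bq <= B ^+ 2 / 64 + 16 * Q ^+ 2.
  move: e2 => /ler_normlP[_ e2].
  by have := sqr_ge0 (B / 8 - 4 * Q); nra.
have E3 : - aq <= A' ^+ 2 / 4 + Q ^+ 2.
  move: e3 => /ler_normlP[e3 _].
  by have := sqr_ge0 (A' / 2 - Q); nra.
have E4 : T * - qv <= T * (Q * V).
  by move: e4 => /ler_normlP[e4 _]; rewrite ler_pM2l.
have := energy_form hT hlam hgam A0 B0 e5 => E5.
have [l0 l1] := andP hlam.
have TT : 0 <= T * (T - lam) by rewrite mulr_ge0//; lra.
have Tl : 0 <= T * lam by rewrite mulr_ge0// ltW.
have sT : 0 <= s * T by rewrite mulr_ge0// ltW.
have sTT : 0 <= s * T ^+ 2 by rewrite mulr_ge0 ?sqr_ge0// ltW.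
(* The weights of [h2] and [h3] add up to [T ^+ 2], so that [f y] cancels against [h1]. *)
have g1 := ler_wpM2l (sqr_ge0 T) h1.
have g2 := ler_wpM2l TT h2.
have g3 := ler_wpM2l Tl h3.
have G1 := ler_wpM2l sTT E1.
have G2 := ler_wpM2l sTT E2.
have G3 := ler_wpM2l sTT E3.
have G5 := ler_wpM2l sT E5.
have P2 := mulr_ge0 sTT (sqr_ge0 P).
have Q2 := mulr_ge0 sTT (sqr_ge0 Q).
lra.
Qed.

End InnerProduct.

(** * Rates of the inertial algorithm *)

Lemma is_cvg_series_of_eseries (R : realType) (u : nat -> R) :
  (forall n, 0 <= u n) -> (\sum_(0 <= k <oo) (u k)%:E < +oo)%E ->
  cvgn (series u).
Proof.
move=> u0 uoo; apply: nondecreasing_is_cvgn; first exact: nondecreasing_series.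
exists (fine (\sum_(0 <= k <oo) (u k)%:E)%E) => _ [n _ <-].
rewrite -lee_fin fineK; last first.
  by rewrite ge0_fin_numE// nneseries_ge0// => k _ _; rewrite lee_fin.
rewrite /series/= -sumEFin; apply: nneseries_lim_ge => k _ _.
by rewrite lee_fin.
Qed.

Lemma minval_argmin (R : realType) (T : Type) (f : T -> R) z :
  argmin f z -> minval f = f z.
Proof.
move=> fz; apply/eqP; rewrite eq_le; apply/andP; split.
  by apply: ge_inf; [exists (f z) => _ [u _ <-]|exists z].
by apply: lb_le_inf; [exists (f z), z|move=> _ [u _ <-]].
Qed.

Ltac nonneg := do ?[exact: sqr_ge0 | by [] | exact: ltW | apply: addr_ge0
  | apply: mulr_ge0 | rewrite invr_ge0].

Section IGAHD.
Context (R : realType) (H : completeNormedModType R).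
Context (ip : {dot H for (@idfun R)}) (hip : induces_norm ip).

Context (f : H -> R^o) (gradf : H -> H) (L : R).
Context (hconvex : convex_function setT f) (hgrad : is_gradient ip f gradf).
Context (hL : 0 < L) (hlip : L.-lipschitz gradf).
Context (alpha s : R) (beta : nat -> R) (Mx My x y : nat -> H).
Context (halpha : 3 < alpha) (hs : 0 < s).
Context (halgo : I_IGAHD L alpha (fun=> s) beta gradf Mx My x y).
Context (cMx : cvgn (series (fun k => k%:R * `|Mx k|))).
Context (cMy : cvgn (series (fun k => k%:R * `|My k|))).
Context (z : H) (hz : argmin f z).

(* Indices are shifted by one: [T n], [w n], [v n] are t_{n+1}, w_{n+1},
   v_{n+1}, and [u n] is t_{n+1} w_{n+1} - (x_{n+1} - x_n). *)
Let tau : R := (alpha - 1)^-1.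
Let gam n : R := beta n / Num.sqrt s.
Let T n : R := n%:R * tau.
Let g n : H := gradf (x n) + Mx n.
Let w n : H := x n.+1 - x n + (gam n * s) *: g n.
Let v n : H := x n - z + T n *: w n.
Let u n : H := (T n - 1) *: w n + (gam n * s) *: g n.
Let phi n : R := f (x n) - f z.

Let F n : R := T n ^+ 2 * phi n.+1 + `|v n| ^+ 2 / (2 * s)
  + s * T n ^+ 2 / 4 * `|gradf (x n.+1)| ^+ 2.
Let U n : R := T n ^+ 2 * phi n.+1 + T n ^+ 2 * `|w n| ^+ 2 / (2 * s)
  + s * T n ^+ 2 / 4 * `|gradf (x n.+1)| ^+ 2.

Let sL : s <= 1 / L. Proof. by have /andP[] := igahd_step halgo 0. Qed.

Let tau_gt0 : 0 < tau.
Proof. by rewrite /tau invr_gt0 subr_gt0; move: halpha; lra. Qed.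

Let tau_lt : tau < 1 / 2.
Proof. by rewrite /tau ltr_pdivlMr// mulrC ltr_pdivrMr; move: halpha; lra. Qed.

Let T_ge0 n : 0 <= T n. Proof. by rewrite mulr_ge0// ltW. Qed.

Let TS n : T n.+1 = T n + tau. Proof. by rewrite /T -natr1 mulrDl mul1r. Qed.

(** [energy_step] requires weights of at least 100, so the estimates hold only from some index
    on. *)
Let T_large : exists K, forall n, (K <= n)%N -> 100 <= T n.
Proof.
exists (Num.truncn (100 / tau)).+1 => n Kn.
rewrite /T -ler_pdivrMr// ltW//; apply: lt_le_trans (truncnS_gt _) _.
by rewrite ler_nat.
Qed.

Let phi_ge0 n : 0 <= phi n. Proof. by rewrite subr_ge0. Qed.

(** * Damping coefficients and exact recursions *)

Let gam02 n : 0 <= gam n <= 2.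
Proof.
have /andP[b0 b2] := igahd_beta halgo n.
have ss : 0 < Num.sqrt s by rewrite sqrtr_gt0.
by rewrite divr_ge0 ?sqrtr_ge0//= ler_pdivrMr// ltW.
Qed.

Let gamE n : beta n * Num.sqrt s = gam n * s.
Proof.
have ss : 0 < Num.sqrt s by rewrite sqrtr_gt0.
by rewrite /gam -{3}(sqr_sqrtr (ltW hs)); field; rewrite gt_eqF.
Qed.

(** For k = n + 1 the weights fit exactly: t_{k+1} (1 - alpha / k) = t_k - 1 and t_{k+1} (1 - 1 / k)
    = t_k. The added gradient term cancels the one with beta_k in y_k. *)
Let y_step n : T n.+1 *: (y n.+1 - x n.+1 + (gam n.+1 * s) *: g n.+1) = u n.
Proof.
rewrite (igahd_y halgo)//= !gamE -/(g n.+1) -/(g n).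
have -> : 1 - 1 / n.+1%:R = n%:R / n.+1%:R :> R.
  by rewrite -natr1; field; rewrite natr1 pnatr_eq0.
have t1 : tau * (alpha - 1) = 1 by rewrite mulVf// gt_eqF//; move: halpha; lra.
have n0 : n.+1%:R != 0 :> R by rewrite pnatr_eq0.
apply: (ip_inj hip) => h; rewrite /u /w /T !ipE.
have -> : n.+1%:R * tau = (n%:R + 1) * tau by rewrite natr1.
move: (ip (x n.+1) h) (ip (x n) h) (ip (g n.+1) h) (ip (g n) h) => a b c d.
have -> : n%:R = n.+1%:R - 1 :> R by rewrite -natr1 addrK.
move: n.+1%:R n0 t1 => N N0 t1.
have -> : alpha = 1 + tau^-1 by rewrite /tau invrK subrKC.
by field; rewrite N0 gt_eqF.
Qed.

Let x_step n : x n.+2 = y n.+1 - s *: (gradf (y n.+1) + My n.+1).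
Proof. exact: (igahd_x halgo). Qed.

Let w_step n :
  T n.+1 *: w n.+1 = u n - (s * T n.+1) *: (gradf (y n.+1) + My n.+1).
Proof.
by rewrite -y_step; apply: (ip_inj hip) => h; rewrite /w x_step !ipE; ring.
Qed.

Let v_u n : v n = x n.+1 - z + u n.
Proof. by apply: (ip_inj hip) => h; rewrite /v /u /w !ipE; ring. Qed.

Let v_step n : v n.+1 = v n - (s * T n.+1) *: (gradf (y n.+1) + My n.+1).
Proof. by rewrite {1}/v w_step v_u addrA. Qed.

(** * Summability of the errors *)

Let P n : R := T n * `|Mx n|.
Let Q n : R := T n * `|My n|.

Let P_ge0 n : 0 <= P n. Proof. exact: mulr_ge0. Qed.
Let Q_ge0 n : 0 <= Q n. Proof. exact: mulr_ge0. Qed.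

Let cP : cvgn (series P).
Proof.
have -> : P = (fun n => tau * (n%:R * `|Mx n|)).
  by apply/funext => n; rewrite /P /T mulrA (mulrC tau).
exact: is_cvg_series_scale.
Qed.

Let cQ : cvgn (series Q).
Proof.
have -> : Q = (fun n => tau * (n%:R * `|My n|)).
  by apply/funext => n; rewrite /Q /T mulrA (mulrC tau).
exact: is_cvg_series_scale.
Qed.

Let err n : R := Q n.+1 + 100 * s * (P n.+1 ^+ 2 + Q n.+1 ^+ 2).

Let err_ge0 n : 0 <= err n.
Proof. by rewrite /err; nonneg. Qed.

Let c_err : cvgn (series err).
Proof.
rewrite /err; apply: is_cvg_series_add.
  by move: cQ => /((is_cvg_series_shift 1 Q).2); under eq_fun do rewrite addn1.
apply: is_cvg_series_scale; apply: is_cvg_series_add.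
  have /((is_cvg_series_shift 1 _).2) := is_cvg_series_sqr P_ge0 cP.
  by under eq_fun do rewrite addn1.
have /((is_cvg_series_shift 1 _).2) := is_cvg_series_sqr Q_ge0 cQ.
by under eq_fun do rewrite addn1.
Qed.

(** With Q = [Q n.+1], the error Q |v| is at most Q (1 + |v|^2), and Q |v|^2 is [eps n] times the
    term |v|^2 / (2 s) of [F]. *)
Let eps n : R := 2 * s * Q n.+1.

Let eps_ge0 n : 0 <= eps n. Proof. by rewrite /eps; nonneg. Qed.

Let c_eps : cvgn (series eps).
Proof.
rewrite /eps; apply: is_cvg_series_scale.
by move: cQ => /((is_cvg_series_shift 1 Q).2); under eq_fun do rewrite addn1.
Qed.

(** * Decrease of the Lyapunov function [F] *)

Let dissF n : R := (1 - 2 * tau) * T n.+1 * phi n.+1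
   + s * T n.+1 ^+ 2 / 16 * `|gradf (x n.+1)| ^+ 2.

Let dissF_ge0 n : 0 <= dissF n.
Proof.
have := tau_lt => ht; have ? : 0 <= 1 - 2 * tau by move: ht; lra.
by rewrite /dissF; nonneg.
Qed.

Let F_ge0 n : 0 <= F n.
Proof.
by rewrite /F; nonneg.
Qed.

Let F_step n : 100 <= T n ->
  F n.+1 + dissF n <= (1 + eps n) * F n + err n.
Proof.
move=> hT; have hT' : 100 <= T n.+1 by rewrite TS ler_wpDr// ltW.
have := energy_step hip hconvex hgrad hL hlip hs sL (lam := 1) (p := Mx n.+1)
  (v := v n) hT' _ (gam02 n.+1) hz (x_step n).
rewrite ler01 lexx => /(_ (x n.+1) isT); rewrite scale1r -/(g n.+1) y_step.
move=> /(_ (v_u n)); rewrite -v_step -/(phi n.+2) -/(phi n.+1).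
rewrite /F /dissF /eps /err /P /Q TS.
move: tau_gt0 tau_lt (phi_ge0 n.+1) hs hT.
move: (normr_ge0 (v n)) (normr_ge0 (My n.+1)).
move: (T n) tau (phi n.+1) s `|v n| `|gradf (x n.+1)| => t r h c V A.
move: `|Mx n.+1| `|My n.+1| => p q V0 q0 r0 r1 h0 c0 ht E.
have t'0 : 0 < t + r by lra.
(* The two sides differ by [r ^+ 2 * h]. The gain has the positive coefficient [1 - 2 * r] because
   alpha > 3. *)
have t1 : (t + r) * (t + r - 1) * h + (1 - 2 * r) * (t + r) * h <= t ^+ 2 * h.
  rewrite -mulrDl; apply: ler_wpM2r => //; nra.
(* Half of this 1/8 pays for the 1/16 in [energy_step]; the other half enters [dissF]. *)
have t2 : c * (t + r) ^+ 2 / 8 * A ^+ 2 <= c * t ^+ 2 / 4 * A ^+ 2.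
  apply: ler_wpM2r; first exact: sqr_ge0.
  rewrite -!mulrA; apply: ler_wpM2l; first exact: ltW.
  nra.
have Q0 : 0 <= (t + r) * q by rewrite mulr_ge0// ltW.
have t3 : (t + r) * q * V <= (t + r) * q * (1 + V ^+ 2).
  apply: ler_wpM2l => //; nra.
have t4 : 2 * c * ((t + r) * q) * (V ^+ 2 / (2 * c)) = (t + r) * q * V ^+ 2.
  by field; rewrite gt_eqF.
have t5 : 0 <= 2 * c * ((t + r) * q) * (t ^+ 2 * h + c * t ^+ 2 / 4 * A ^+ 2).
  by nonneg.
lra.
Qed.

Let c_dissF : cvgn (series dissF).
Proof.
have [K TK] := T_large.
have [||//] := @robbins_siegmund _ K F dissF eps err _ _ c_eps c_err.
  by move=> n _; split.
by move=> n /TK /F_step.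
Qed.

Let one_sub_tau_gt0 : 0 < 1 - 2 * tau.
Proof. by have := tau_lt => ht; move: ht; lra. Qed.

(** Besides giving both series, this bounds the terms that become errors in the estimate for [U]. *)
Let dissF_bound n : T n.+1 * phi n.+1
   + s * T n.+1 ^+ 2 / 16 * `|gradf (x n.+1)| ^+ 2 <=
  (1 - 2 * tau)^-1 * dissF n.
Proof.
have X0 : 0 <= s * T n.+1 ^+ 2 / 16 * `|gradf (x n.+1)| ^+ 2 by nonneg.
have i1 : 1 <= (1 - 2 * tau)^-1.
  by rewrite invf_ge1//; have := tau_gt0 => t0; move: t0; lra.
have i0 : 1 - 2 * tau != 0 by rewrite gt_eqF.
rewrite /dissF; move: (1 - 2 * tau) i0 i1 (T n.+1 ^+ 2) X0 => a a0 a1 t2.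
move: (T n.+1) (phi n.+1) => t h X0.
rewrite mulrDr !mulrA mulVf// mul1r lerD2l -!(mulrA a^-1) ler_peMl//.
by move: X0; rewrite expr2 !mulrA.
Qed.

Let c_phi : cvgn (series (fun n => T n * phi n)).
Proof.
apply/(is_cvg_series_shift 1); under eq_fun do rewrite addn1.
apply: (is_cvg_series_le (K := 0))
  (is_cvg_series_scale (c := (1 - 2 * tau)^-1) c_dissF).
move=> n _; rewrite mulr_ge0//=; apply: le_trans (dissF_bound n).
by rewrite lerDl; nonneg.
Qed.

Let c_grad : cvgn (series (fun n => T n ^+ 2 * `|gradf (x n)| ^+ 2)).
Proof.
apply/(is_cvg_series_shift 1); under eq_fun do rewrite addn1.
apply: (is_cvg_series_le (K := 0))
  (is_cvg_series_scale (c := 16 / s * (1 - 2 * tau)^-1) c_dissF).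
move=> n _; apply/andP; split; first by nonneg.
have -> : T n.+1 ^+ 2 * `|gradf (x n.+1)| ^+ 2 =
  16 / s * (s * T n.+1 ^+ 2 / 16 * `|gradf (x n.+1)| ^+ 2).
  by move: (T _) => t; field; rewrite gt_eqF.
rewrite -[leRHS]mulrA; apply: ler_wpM2l; first by nonneg.
apply: le_trans (dissF_bound n).
by rewrite lerDr mulr_ge0.
Qed.

(** * Energy estimate for [U] *)

Let S n : R := T n ^+ 2 * `|g n| ^+ 2.

Let S_ge0 n : 0 <= S n. Proof. by rewrite /S; nonneg. Qed.

Let c_S : cvgn (series S).
Proof.
apply: (is_cvg_series_le (K := 0)) (is_cvg_series_scale (c := 2)
  (is_cvg_series_add c_grad (is_cvg_series_sqr P_ge0 cP))).
move=> n _; rewrite S_ge0 /= /S /P (exprMn _ (T n) `|Mx n|) -mulrDr (mulrCA 2).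
apply: ler_wpM2l; first exact: sqr_ge0.
have h : `|g n| ^+ 2 <= (`|gradf (x n)| + `|Mx n|) ^+ 2.
  by rewrite ler_pXn2r ?nnegrE ?addr_ge0// ler_normD.
by have := sqr_ge0 (`|gradf (x n)| - `|Mx n|); lra.
Qed.

(** For [lam = 0] the weight of [phi] grows; its excess and the gradient term are at most the first
    summand. The 7 is 6 + 1, from [t2'] and [t3]. *)
Let errU n : R := (1 - 2 * tau)^-1 * dissF n + 7 * s * S n + 2 * err n.

Let U_ge0 n : 0 <= U n. Proof. by rewrite /U; nonneg. Qed.

Let dissU n : R := T n * `|w n| ^+ 2 / (2 * s).

Let dissU_ge0 n : 0 <= dissU n. Proof. by rewrite /dissU; nonneg. Qed.

Let u_le n : 1 <= T n -> `|u n| <= (T n - 1) * `|w n| + 2 * s * `|g n|.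
Proof.
move=> hT; apply: le_trans (ler_normD _ _) _.
have /andP[g0 g2] := gam02 n.
have gs : 0 <= gam n * s by nonneg.
rewrite (normrZ (T n - 1)) (normrZ (gam n * s)) (ger0_norm gs).
rewrite ger0_norm ?subr_ge0// lerD2l.
by apply: ler_wpM2r => //; apply: ler_wpM2r => //; exact: ltW.
Qed.

Let U_step n : 100 <= T n ->
  U n.+1 + dissU n <= (1 + eps n) * U n + errU n.
Proof.
move=> hT; have hT' : 100 <= T n.+1 by rewrite TS ler_wpDr// ltW.
have hT1 : 1 <= T n by apply: le_trans hT; rewrite ler1n.
have := energy_step hip hconvex hgrad hL hlip hs sL (lam := 0) (p := Mx n.+1)
  (v := u n) hT' _ (gam02 n.+1) hz (x_step n).
rewrite ler01 lexx => /(_ (x n.+1) isT).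
rewrite scale0r add0r -/(g n.+1) y_step => /(_ erefl); rewrite -w_step normrZ.
rewrite (ger0_norm (T_ge0 _)) (exprMn _ (T n.+1) `|w n.+1|) subr0.
rewrite -/(phi n.+2) -/(phi n.+1).
have := dissF_bound n; have := u_le hT1.
rewrite /U /errU; move: (dissF n) => D.
rewrite /eps /dissU /err /S /P /Q TS.
move: tau_gt0 tau_lt (phi_ge0 n.+1) hs hT.
move: (normr_ge0 (u n)) (normr_ge0 (My n.+1)).
move: (normr_ge0 (w n)) (normr_ge0 (g n)).
move: ((1 - 2 * tau)^-1 * D) => {}D.
move: (T n) tau (phi n.+1) s `|u n| `|w n| `|g n| `|gradf (x n.+1)|.
move=> t r h c V W G A.
move: `|Mx n.+1| `|My n.+1| => p q W0 G0 V0 q0 r0 r1 h0 c0 ht VWG D1 E.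
have t'0 : 0 < t + r by lra.
have t1 : (t + r) * (t + r) * h <= t ^+ 2 * h + (t + r) * h.
  rewrite -mulrDl; apply: ler_wpM2r => //; nra.
have WG : 0 <= (t - 1) * W by rewrite mulr_ge0//; lra.
have cG : 0 <= 2 * c * G by nonneg.
have G2 : G ^+ 2 <= t * G ^+ 2 by rewrite ler_peMl ?sqr_ge0//; lra.
have tG2 : t * G ^+ 2 <= t ^+ 2 * G ^+ 2.
  by rewrite ler_wpM2r ?sqr_ge0// expr2 ler_peMl//; lra.
(* Expanding [(t - 1) ^+ 2] loses [2 * t * W ^+ 2]: [dissU] keeps half, [y1] spends a quarter on the
   cross term, and [y2] absorbs the remaining [W ^+ 2]. The 12 is 8 + 4. *)
have t2 : V ^+ 2 <= (t ^+ 2 - t) * W ^+ 2 + 12 * c ^+ 2 * (t * G ^+ 2).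
  have VV : V ^+ 2 <= ((t - 1) * W + 2 * c * G) ^+ 2.
    by rewrite ler_pXn2r ?nnegrE ?addr_ge0.
  have y1 : 0 <= t / 2 * (W - 4 * c * G) ^+ 2.
    by rewrite mulr_ge0 ?sqr_ge0//; lra.
  have y2 : 0 <= (t / 2 - 1) * W ^+ 2 by rewrite mulr_ge0 ?sqr_ge0//; lra.
  have y3 : 0 <= c * (W * G) by nonneg.
  have y4 := ler_wpM2l (sqr_ge0 c) G2.
  lra.
have t2' : V ^+ 2 / (2 * c) <= t ^+ 2 * W ^+ 2 / (2 * c) - t * W ^+ 2 / (2 * c)
    + 6 * c * (t * G ^+ 2).
  rewrite ler_pdivrMr ?mulr_gt0//; apply: le_trans t2 _.
  by rewrite le_eqVlt; apply/orP; left; apply/eqP; field; rewrite gt_eqF.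
set K := (t + r) * q; have K0 : 0 <= K by rewrite mulr_ge0// ltW.
have t3 : K * V <= K * (1 + t ^+ 2 * W ^+ 2) + c * (K ^+ 2 + G ^+ 2).
  have z1 : K * V <= K * (t * W + 2 * c * G) by apply: ler_wpM2l => //; lra.
  have z2 : K * (t * W) <= K * (1 + t ^+ 2 * W ^+ 2).
    apply: ler_wpM2l => //.
    by have := sqr_ge0 (t * W - 1); have := sqr_ge0 (t * W); nra.
  have z3 : 0 <= c * (K - G) ^+ 2 by nonneg.
  lra.
have t4 : 2 * c * K * (t ^+ 2 * W ^+ 2 / (2 * c)) = K * (t ^+ 2 * W ^+ 2).
  by field; rewrite gt_eqF.
have t5 : 0 <= (1 + 2 * c * K) * (c * t ^+ 2 / 4 * A ^+ 2).
  by nonneg.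
have t6 : 0 <= 2 * c * K * (t ^+ 2 * h) by nonneg.
have t7 : 0 <= c * K ^+ 2 by nonneg.
have t8 : 0 <= c * ((t + r) * p) ^+ 2 by nonneg.
have t9 := ler_wpM2l (ltW c0) G2.
have t10 := ler_wpM2l (ltW c0) tG2.
have E' : 100 * c * (t + r) ^+ 2 * (p ^+ 2 + q ^+ 2) =
   100 * c * (((t + r) * p) ^+ 2 + K ^+ 2) by rewrite /K; ring.
move: E' t7 t8 t3 t4 t5 t6 t2' E; rewrite -/K.
move: (V ^+ 2 / (2 * c)) (t ^+ 2 * W ^+ 2 / (2 * c)) (t * W ^+ 2 / (2 * c)).
by move=> V2 B B'; lra.
Qed.

Let cvg_U_diss : cvgn U /\ cvgn (series dissU).
Proof.
have [K TK] := T_large.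
have c_errU : cvgn (series errU).
  apply: (is_cvg_series_add (is_cvg_series_add (is_cvg_series_scale c_dissF)
    (is_cvg_series_scale c_S)) (is_cvg_series_scale c_err)).
apply: (robbins_siegmund (K := K) _ _ c_eps c_errU) => n Kn.
  have ? : 0 <= (1 - 2 * tau)^-1 by rewrite invr_ge0 ltW.
  by split=> //; rewrite /errU; nonneg.
exact: U_step (TK n Kn).
Qed.

(** As [T n * harmonic n <= 1], the harmonic weight removes one factor [T n], so the three parts of
    [U] fall under the series of [T * phi], of [dissU] and of the squared gradients. *)
Let cvg_U0 : U @ \oo --> 0.
Proof.
have [cU c_dissU] := cvg_U_diss.
apply: (cvgn0_of_harmonic_series U_ge0 cU).
have c1 : cvgn (series (fun n => T n.+1 * phi n.+1)).
  have /((is_cvg_series_shift 1 _).2) := c_phi.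
  by under eq_fun do rewrite addn1.
have c2 : cvgn (series (fun n => T n.+1 ^+ 2 * `|gradf (x n.+1)| ^+ 2)).
  have /((is_cvg_series_shift 1 _).2) := c_grad.
  by under eq_fun do rewrite addn1.
apply: (is_cvg_series_le (K := 0)) (is_cvg_series_add c1
  (is_cvg_series_add c_dissU (is_cvg_series_scale (c := s / 4) c2))) => n _.
have h0 : 0 <= @harmonic R n by exact: harmonic_ge0.
rewrite mulr_ge0//=.
have h1 : @harmonic R n <= 1 by rewrite /harmonic/= invf_le1// ler1n.
have Th : T n * harmonic n <= 1.
  have nh : n%:R * @harmonic R n <= 1.
    by rewrite /harmonic/= ler_pdivrMr// mul1r ler_nat.
  rewrite /T mulrAC mulr_ile1 ?mulr_ge0 ?(ltW tau_gt0)//.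
  by apply: le_trans (ltW tau_lt) _; rewrite ler_pdivrMr// mul1r ler1n.
have Th0 : 0 <= T n * harmonic n by exact: mulr_ge0.
have TT : T n <= T n.+1 by rewrite TS lerDl ltW.
have -> : U n * harmonic n = T n * harmonic n * (T n * phi n.+1) +
  (T n * harmonic n * dissU n +
   harmonic n * (s / 4 * (T n ^+ 2 * `|gradf (x n.+1)| ^+ 2))).
  by rewrite /U /dissU; move: (T n) (phi n.+1) => t p; ring.
apply: lerD.
  apply: le_trans (_ : 1 * (T n.+1 * phi n.+1) <= _); last by rewrite mul1r.
  by apply: ler_pM => //; [exact: mulr_ge0|exact: ler_wpM2r].
apply: lerD; first by rewrite ler_piMl.
apply: le_trans (_ : 1 * (s / 4 * (T n.+1 ^+ 2 * `|gradf (x n.+1)| ^+ 2)) <= _);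
  last by rewrite mul1r.
apply: ler_pM => //; first by nonneg.
apply: ler_wpM2l; first by nonneg.
apply: ler_wpM2r; first exact: sqr_ge0.
by rewrite ler_pXn2r ?nnegrE.
Qed.

(** * From the limit of [U] to the rates *)

Let rate (h Z : nat -> R) :
  (forall n, 0 <= h n) -> (forall n, T n ^+ 2 * h n.+1 <= Z n) ->
  Z @ \oo --> 0 -> forall e, 0 < e -> \forall k \near \oo, k%:R ^+ 2 * h k <= e.
Proof.
move=> h0 hZ /cvgrPdist_lt Z0 e e0.
(* The factor [tau ^+ 2] comes from [T n], and 4 from (n + 1)^2 <= 4 n^2 for n >= 1. *)
have d0 : 0 < e * tau ^+ 2 / 4 by rewrite divr_gt0// mulr_gt0// exprn_gt0.
have [N _ ZN] := Z0 _ d0.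
exists N.+2 => // -[|n]// /= Nn.
have : Z n < e * tau ^+ 2 / 4.
  have := ZN n (ltnW Nn); rewrite /= sub0r normrN; apply: le_lt_trans.
  exact: ler_norm.
move=> /(le_lt_trans (hZ n)) => hn.
have n1 : 1 <= n%:R :> R by rewrite ler1n -ltnS (leq_trans _ Nn).
have {hn} : n%:R ^+ 2 * h n.+1 < e / 4.
  by rewrite -(@ltr_pM2r _ (tau ^+ 2)) ?exprn_gt0// mulrAC -exprMn (mulrAC e).
have : n.+1%:R ^+ 2 * h n.+1 <= 4 * n%:R ^+ 2 * h n.+1.
  by apply: ler_wpM2r => //; rewrite -natr1; nra.
lra.
Qed.

Lemma igahd_value_rate (e : R) : 0 < e ->
  \forall k \near \oo, k%:R ^+ 2 * (f (x k) - f z) <= e.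
Proof.
apply: rate cvg_U0 _ => // n; rewrite /U -addrA lerDl.
by nonneg.
Qed.

(** The velocity differs from [w n] by a vector of norm at most [2 * s * |g n|], and [S n] tends to
    0 as the term of a convergent series. *)
Lemma igahd_velocity_rate (e : R) : 0 < e ->
  \forall k \near \oo, k%:R ^+ 2 * `|x k - x k.-1| ^+ 2 <= e.
Proof.
apply: (@rate _ (fun n => 4 * s * U n + 8 * s ^+ 2 * S n)) => [n|n|];
  first exact: sqr_ge0; last first.
  have -> : 0 = 4 * s * 0 + 8 * s ^+ 2 * 0 :> R by rewrite !mulr0 addr0.
  apply: cvgD; apply: cvgM; [exact: cvg_cst|exact: cvg_U0|exact: cvg_cst|].
  exact: cvg_series_cvg_0 c_S.
rewrite /= /U /S.
have -> : x n.+1 - x n = w n - (gam n * s) *: g n by rewrite /w addrK.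
have /andP[g0 g2] := gam02 n.
have gs : 0 <= gam n * s by nonneg.
set d := _ - _; have le_d : `|d| <= `|w n| + 2 * s * `|g n|.
  apply: le_trans (ler_normB _ _) _.
  rewrite (normrZ (gam n * s)) (ger0_norm gs) lerD2l.
  by apply: ler_wpM2r => //; apply: ler_wpM2r => //; exact: ltW.
have -> : 4 * s * (T n ^+ 2 * phi n.+1 + T n ^+ 2 * `|w n| ^+ 2 / (2 * s) +
    s * T n ^+ 2 / 4 * `|gradf (x n.+1)| ^+ 2)
    + 8 * s ^+ 2 * (T n ^+ 2 * `|g n| ^+ 2)
  = T n ^+ 2 * (2 * `|w n| ^+ 2 + 8 * s ^+ 2 * `|g n| ^+ 2)
    + (4 * s * (T n ^+ 2 * phi n.+1)
    + s ^+ 2 * (T n ^+ 2 * `|gradf (x n.+1)| ^+ 2)).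
  by move: (T n) (phi n.+1) => t p; field; rewrite gt_eqF.
rewrite ler_wpDr//; first by nonneg.
apply: ler_wpM2l; first exact: sqr_ge0.
have d2 : `|d| ^+ 2 <= (`|w n| + 2 * s * `|g n|) ^+ 2.
  by rewrite ler_pXn2r// ?nnegrE; nonneg.
apply: le_trans d2 _; have := sqr_ge0 (`|w n| - 2 * s * `|g n|).
by move: s `|w n| `|g n| => c W G; lra.
Qed.

End IGAHD.

Theorem theorem2p2 (R : realType) (H : completeNormedModType R)
    (ip : {dot H for (@idfun R)}) (hip : induces_norm ip)
    (f : H -> R^o) (gradf : H -> H) (L : R)
    (hconvex : convex_function setT f)
    (hgrad : is_gradient ip f gradf)
    (hL : 0 < L) (hlip : L.-lipschitz gradf)
    (hargmin : argmin f !=set0)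
    (alpha s : R) (beta : nat -> R) (Mx My x y : nat -> H)
    (halpha : 3 < alpha) (hs : 0 < s)
    (halgo : I_IGAHD L alpha (fun=> s) beta gradf Mx My x y)
    (hMx : (\sum_(0 <= k <oo) (s * k%:R * `|Mx k|)%:E < +oo)%E)
    (hMy : (\sum_(0 <= k <oo) (s * k%:R * `|My k|)%:E < +oo)%E) :
  (fun k : nat => f (x k) - minval f : R^o) =o_\oo
    (fun k : nat => (1 / k%:R ^+ 2 : R^o)) /\
  (fun k : nat => (`|x k - x k.-1| : R^o)) =o_\oo
    (fun k : nat => (1 / k%:R : R^o)).
Proof.
have [z hz] := hargmin.
have cM (M : nat -> H) : (\sum_(0 <= k <oo) (s * k%:R * `|M k|)%:E < +oo)%E ->
    cvgn (series (fun k => k%:R * `|M k|)).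
  move=> /is_cvg_series_of_eseries cM.
  have -> : (fun k => k%:R * `|M k|) = (fun k => s^-1 * (s * k%:R * `|M k|)).
    by apply/funext => k; rewrite -mulrA mulKf// gt_eqF.
  by apply: is_cvg_series_scale; apply: cM => k; rewrite !mulr_ge0// ltW.
have value := igahd_value_rate hip hconvex hgrad hL hlip halpha hs halgo
  (cM _ hMx) (cM _ hMy) hz.
have velocity := igahd_velocity_rate hip hconvex hgrad hL hlip halpha hs halgo
  (cM _ hMx) (cM _ hMy) hz.
rewrite (minval_argmin hz); split; apply/eqoP => e e0.
  near=> k.
  have k0 : 0 < k%:R :> R by rewrite ltr0n; near: k; exists 1%N.
  rewrite ger0_norm ?subr_ge0 ?hz// ger0_norm ?divr_ge0 ?sqr_ge0//.
  rewrite mulrA mulr1 ler_pdivlMr ?exprn_gt0// mulrC.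
  by near: k; exact: value.
near=> k.
have k0 : 0 < k%:R :> R by rewrite ltr0n; near: k; exists 1%N.
rewrite normr_id ger0_norm ?divr_ge0// mulrA mulr1 ler_pdivlMr//.
(* The velocity estimate concerns squares, so it is used with [e ^+ 2]. *)
rewrite -(@ler_pXn2r _ 2) ?nnegrE ?mulr_ge0 ?(ltW e0)// exprMn mulrC.
by near: k; apply: velocity; rewrite exprn_gt0.
Unshelve. all: by end_near.
Qed.
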